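(* Let $j,n$ be integers with $2\leq j\leq\frac{n}{2}$ and let $e=n+1$. Then $$\lambda(C_n^{\{0,2\}})=\begin{cases}4&\text{if }e\leq8;\\5&\text{if }e=9;\\ \left\lceil\frac{-1+\sqrt{8e+17}}{2}\right\rceil&\text{if }e\geq10\text{ and }\left\lceil\frac{-1+\sqrt{8e+17}}{2}\right\rceil\text{ is odd};\\ \left\lceil\sqrt{2e-2}\right\rceil&\text{otherwise,}\end{cases}$$ and if $j\geq3$, then $$\lambda(C_n^{\{0,j\}})=\begin{cases}4&\text{if }e\leq6;\\ \left\lceil\frac{-1+\sqrt{8e+1}}{2}\right\rceil&\text{if }e\geq7\text{ and }\left\lceil\frac{-1+\sqrt{8e+1}}{2}\right\rceil\text{ is odd};\\ \left\lceil\sqrt{2e-2}\right\rceil&\text{otherwise.}\end{cases}$$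
   Context: For a graph $G$, the edge-distinguishing chromatic number $\lambda(G)$ is the minimum positive integer $k$ for which there is a vertex coloring $c:V(G)\to\{1,\dotsc,k\}$ such that the edge labels $\{c(u),c(v)\}$ are distinct for distinct edges $uv$. For $2\leq j\leq n/2$, $C_n^{\{0,j\}}$ is the cycle $w_0w_1\dotsb w_{n-1}w_0$ on $n$ vertices together with one chord $w_0w_j$; it has $n+1$ edges. *)

(* Defs.v *)
From mathcomp Require Import all_boot all_order all_algebra.
From mathcomp Require Export reals.

Set Implicit Arguments.
Unset Strict Implicit.
Unset Printing Implicit Defensive.

Record sgraph := SGraph {
  vertex :> finType;
  adj : rel vertex;
  adj_sym : symmetric adj;
  adj_irr : irreflexive adj }.

Definition edges (G : sgraph) : {set {set G}} :=
  [set [set u; v] | u in G, v in G & adj u v].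

(* The label {c(u), c(v)} of the edge A = {u, v} is the image c @: A, which is
   a singleton when c u = c v.  The k colours are the elements of 'I_k. *)
Definition edge_distinguishing (G : sgraph) (k : nat)
    (c : {ffun G -> 'I_k}) : bool :=
  [forall A in edges G, forall B in edges G, (c @: A == c @: B) ==> (A == B)].

Definition ed_colorable (G : sgraph) (k : nat) : bool :=
  (0 < k) && [exists c : {ffun G -> 'I_k}, edge_distinguishing c].

Lemma ex_ed_colorable (G : sgraph) : exists k, ed_colorable G k.
Proof.
exists #|G|.+1; apply/andP; split=> //; apply/existsP.
pose f (x : G) := widen_ord (leqnSn #|G|) (enum_rank x).
have f_inj : injective f.
  by move=> x y /(congr1 val) /= /val_inj /enum_rank_inj.
exists (finfun f); apply/forall_inP=> A _; apply/forall_inP=> B _.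
have fE : finfun f =1 f by exact: ffunE.
rewrite !(eq_imset _ fE); apply/implyP=> /eqP eAB.
exact/eqP/(imset_inj f_inj).
Qed.

Definition ed_chromatic (G : sgraph) : nat := ex_minn (ex_ed_colorable G).

Section CycleWithChord.
Variables (n j : nat).

Definition cycle_or_chord (u v : 'I_n) : bool :=
  (v == u.+1 %% n :> nat) || (u == 0 :> nat) && (v == j :> nat).

(* The conjunct u != v only matters in degenerate cases
   (n = 1, or j = 0): it is redundant when 0 < j and 1 < n. *)
Definition cycle_chord_adj : rel 'I_n :=
  fun u v => (u != v) && (cycle_or_chord u v || cycle_or_chord v u).

Lemma cycle_chord_sym : symmetric cycle_chord_adj.
Proof. by move=> u v; rewrite /cycle_chord_adj eq_sym orbC. Qed.

Lemma cycle_chord_irr : irreflexive cycle_chord_adj.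
Proof. by move=> u; rewrite /cycle_chord_adj eqxx. Qed.

Definition cycle_chord : sgraph := SGraph cycle_chord_sym cycle_chord_irr.

End CycleWithChord.

(* Main.v *)
(* A colouring of C_n^{0,j} with distinct edge labels is a closed trail of
   length n in the complete graph with loops on k vertices, together with an
   unused edge or loop joining its vertices at times 0 and j.

   Necessity.  Every colour other than the two ends of the chord lies on an even
   number of non-loop labels.  For k even it would lie on k - 1 of them if none
   were missing, so at least (k - 2) / 2 labels are missing.  For k odd and
   j = 2 the ends of the chord are distinct and each of them misses a label, and
   these two labels differ because the chord itself is present.

   Sufficiency.  Going from k to k + 2 colours, the 2k + 3 edges and loops at
   the two new colours contain closed trails of every length from 3 up to 2k + 3
   (k odd) or 2k + 2 (k even); splicing one into the longer arc of the trail
   gives an induction on k, starting from a finite table. *)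

Require Import Defs.
From mathcomp Require Import all_boot all_order all_algebra reals.
From mathcomp Require Import zify ring lra.
Import GRing.Theory Num.Theory.
Local Open Scope nat_scope.

(** * Trails in the complete graph with loops *)

(** A sorted pair stands for the unordered label, loops included, so that distinctness of labels is
    [uniq] of a list and can be computed. *)
Definition lab (u v : nat) : nat * nat := (minn u v, maxn u v).

Lemma labC u v : lab u v = lab v u.
Proof. by rewrite /lab minnC maxnC. Qed.

Lemma lab_lt u v : u < v -> lab u v = (u, v).
Proof. by rewrite /lab; move=> uv; congr pair; lia. Qed.

Lemma lab_diag u : lab u u = (u, u).
Proof. by rewrite /lab minnn maxnn. Qed.

Lemma lab_eq u v u' v' :
  lab u v = lab u' v' -> u = u' /\ v = v' \/ u = v' /\ v = u'.
Proof. by case; lia. Qed.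

(** The chord cuts the cycle into arcs of lengths [j] and [l]. Keeping both instead of their sum
    lets one arc grow while the other stays fixed. *)
Definition chorded_trail (k j l x : nat) (s : seq nat) : bool :=
  [&& size s == j + l, last x s == x, all (gtn k) (x :: s)
    & uniq (lab x (nth x (x :: s) j) :: pairmap lab x s)].

Definition has_chorded_trail k j l : Prop :=
  exists x s, chorded_trail k j l x s.

Lemma chorded_trail_mono k k' j l :
  k <= k' -> has_chorded_trail k j l -> has_chorded_trail k' j l.
Proof.
move=> kk' [x [s /and4P[ss ls sk us]]]; exists x, s; apply/and4P; split=> //.
by apply: sub_all sk => i /= /leq_trans; apply.
Qed.

(** Rotate the closed trail to start at the other end of the chord; its labels are only permuted. *)
Lemma chorded_trail_sym k j l :
  has_chorded_trail k j l -> has_chorded_trail k l j.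
Proof.
move=> [x [s /and4P[/eqP ss /eqP ls sk us]]].
set y := nth x (x :: s) j in us.
have lt : last x (take j s) = y.
  rewrite (last_nth x) size_takel ?ss ?leq_addr // /y.
  by case: (j) => //= i; rewrite nth_take.
have ld : last y (drop j s) = x by rewrite -lt -last_cat cat_take_drop.
exists y, (drop j s ++ take j s); apply/and4P; split.
- by rewrite size_cat size_drop size_take ss; case: ltnP; lia.
- by rewrite last_cat ld lt.
- have ys : y \in x :: s by rewrite mem_nth //= ss ltnS leq_addr.
  apply/allP => z; rewrite inE mem_cat => /or3P[/eqP->|/mem_drop zs|/mem_take zs];
    by apply: (allP sk); rewrite ?inE ?zs ?orbT.
have -> : nth y (y :: drop j s ++ take j s) l = x.
  have sd : size (drop j s) = l by rewrite size_drop ss; lia.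
  by rewrite -cat_cons nth_cat /= sd ltnS leqnn -[in nth _ _ l]sd nth_last.
rewrite labC -(perm_uniq (s1 := lab x y :: pairmap lab x s)) // perm_cons.
by rewrite -{1}(cat_take_drop j s) !pairmap_cat lt ld perm_catC.
Qed.

(** Each entry of [us] is a bridge between the two hubs, crossed once; the parity of their number
    decides at which hub the walk stops. *)
Fixpoint zigzag (h h' : nat) (us : seq nat) : seq nat :=
  if us is u :: us' then u :: h' :: zigzag h' h us' else [::].

Lemma size_zigzag h h' us : size (zigzag h h' us) = (size us).*2.
Proof. by elim: us h h' => //= u us IH h h'; rewrite IH doubleS. Qed.

Lemma all_zigzag (P : pred nat) h h' us :
  P h -> P h' -> all P (zigzag h h' us) = all P us.
Proof. by elim: us h h' => //= u us IH h h' Ph Ph'; rewrite IH // Ph'. Qed.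

Lemma last_zigzag h h' us :
  last h (zigzag h h' us) = if odd (size us) then h' else h.
Proof. by elim: us h h' => //= u us IH h h'; rewrite IH if_neg. Qed.

Lemma zigzag_labels k h h' us : all (gtn k) us -> k <= h -> k <= h' ->
  {in pairmap lab h (zigzag h h' us), forall p,
     p.1 \in us /\ (p.2 == h) || (p.2 == h')}.
Proof.
move=> + + + p; elim: us h h' => //= u us IH h h' /andP[uk usk] hk hk'.
rewrite !inE => /or3P[/eqP->|/eqP->|/IH].
- by rewrite labC lab_lt /= ?eqxx //; lia.
- by rewrite lab_lt /= ?eqxx ?orbT //; lia.
by move=> /(_ usk hk' hk) [-> /orP[]->]; rewrite ?orbT.
Qed.

Lemma zigzag_uniq k h h' us : all (gtn k) us -> k <= h -> k <= h' ->
  h != h' -> uniq us -> uniq (pairmap lab h (zigzag h h' us)).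
Proof.
elim: us h h' => //= u us IH h h' /andP[uk usk] hk hk' hh' /andP[uus uu].
rewrite labC !lab_lt; [|lia..].
rewrite /= IH // 1?eq_sym // andbT inE negb_or -andbA; apply/and3P; split.
- by apply: contra hh' => /eqP[->].
- by apply: contra uus => /zigzag_labels-/(_ k usk hk' hk)[].
by apply: contra uus => /zigzag_labels-/(_ k usk hk' hk)[].
Qed.

Lemma pairmap_lt k x s : x < k -> all (gtn k) s ->
  {in pairmap lab x s, forall p, p.2 < k}.
Proof.
move=> + + p; elim: s x => //= v s IH x xk /andP[vk sk].
rewrite inE => /orP[/eqP->|/(IH _ vk sk)//].
by rewrite /= gtn_max xk.
Qed.

(* The new colours k and k+1 are joined to x and to q further old colours by
   one closed trail at x, which alternates between new and old colours; the
   edge between the new colours is needed exactly when q is even, and up to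
   two new loops are optional. *)
Lemma chorded_trail_step k j l q c : q < k -> c <= 2 ->
  has_chorded_trail k j l ->
  has_chorded_trail k.+2 j (l + q.+1.*2 + ~~ odd q + c).
Proof.
move=> qk c2 [x [s /and4P[/eqP ss /eqP ls sk us]]].
have xk : x < k by case/andP: sk.
pose vs := take q (rem x (iota 0 k)).
have sv : size vs = q.
  rewrite size_take size_rem ?size_iota ?mem_iota //; case: ltnP; lia.
have uv : uniq vs by rewrite take_uniq // rem_uniq ?iota_uniq.
have vP v : v \in vs -> v < k /\ v != x.
  by move=> /mem_take; rewrite mem_rem_uniq ?iota_uniq // !inE mem_iota; case/andP.
have vk : all (gtn k) vs by apply/allP => v /vP[].
pose c1 : bool := 0 < c; pose c2' : bool := 1 < c.
have cE : c = c1 + c2' by rewrite /c1 /c2'; lia.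
(* The detour goes out to [k.+1], takes an optional loop, zigzags, crosses to [k] when [q] is even
   (the zigzag then stops at [k.+1]), takes an optional loop and returns to [x]. *)
pose t := k.+1 :: nseq c1 k.+1 ++ zigzag k.+1 k vs ++ nseq (~~ odd q) k
            ++ nseq c2' k ++ [:: x].
exists x, (s ++ t); apply/and4P; split.
- rewrite size_cat /t /= !size_cat size_zigzag /= !size_nseq sv ss cE.
  by apply/eqP; lia.
- by rewrite last_cat ls /t /= !last_cat.
- have up r : all (gtn k) r -> all (gtn k.+2) r.
    by apply: sub_all => v /= vk2; rewrite ltnW // ltnW.
  rewrite -cat_cons all_cat (up _ sk) /t /= !all_cat !all_nseq all_zigzag /=; [|lia..].
  by rewrite up //= !ltnS leqnn leqnSn !orbT /=; lia.
have nE : nth x (x :: s ++ t) j = nth x (x :: s) j.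
  by rewrite -cat_cons nth_cat /= ss ltnS leq_addr.
rewrite nE pairmap_cat ls -cat_cons cat_uniq us andTb.
(* Old labels have their larger end below [k] and those of the detour do not, so the two families
   are disjoint. *)
have oldP : {in lab x (nth x (x :: s) j) :: pairmap lab x s, forall p, p.2 < k}.
  have yk : nth x (x :: s) j < k by apply: (allP sk); rewrite mem_nth //= ss; lia.
  move=> p; rewrite inE => /orP[/eqP->|]; first by rewrite /= gtn_max xk.
  by apply: pairmap_lt => //; case/andP: sk.
have zP := @zigzag_labels k k.+1 k vs vk (leqnSn k) (leqnn k).
have zU := @zigzag_uniq k k.+1 k vs vk (leqnSn k) (leqnn k) _ uv.
have lz := last_zigzag k.+1 k vs; rewrite sv in lz.
have tE : pairmap lab x t = (x, k.+1) :: nseq c1 (k.+1, k.+1)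
   ++ pairmap lab k.+1 (zigzag k.+1 k vs) ++ nseq (~~ odd q) (k, k.+1)
   ++ nseq c2' (k, k) ++ [:: (x, k)].
  rewrite /t /= lab_lt 1?ltnW // pairmap_cat.
  have -> : last k.+1 (nseq c1 k.+1) = k.+1 by case: (c1).
  rewrite pairmap_cat lz pairmap_cat.
  have -> : last (if odd q then k else k.+1) (nseq (~~ odd q) k) = k by case: odd.
  rewrite pairmap_cat; have -> : last k (nseq c2' k) = k by case: (c2').
  congr cons; congr cat; first by case: (c1) => //=; rewrite lab_diag.
  congr cat; congr cat; first by case: odd => //=; rewrite labC lab_lt.
  congr cat; first by case: (c2') => //=; rewrite lab_diag.
  by rewrite /= labC lab_lt.
have xz h : (x, h) \notin pairmap lab k.+1 (zigzag k.+1 k vs).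
  by apply/negP => /zP[/vP[_]]; rewrite eqxx.
have kz h h' : k <= h -> (h, h') \notin pairmap lab k.+1 (zigzag k.+1 k vs).
  by move=> kh; apply/negP => /zP[/vP[]] /=; lia.
rewrite tE; apply/andP; split.
  apply/hasPn => p /=; rewrite inE !mem_cat !mem_nseq inE => pt.
  apply/negP => /oldP; rewrite ltnNge => /negP; apply.
  case/or3P: pt => [/eqP->|/andP[_ /eqP->]|/orP[/zP[_ /orP[]/eqP->]|]];
    rewrite ?leqnn ?leqnSn //.
  by case/or3P=> [/andP[_ /eqP->]|/andP[_ /eqP->]|/eqP->] /=; rewrite ?leqnSn.
have {}zU : uniq (pairmap lab k.+1 (zigzag k.+1 k vs)) by apply: zU; lia.
move: (pairmap lab k.+1 _) xz kz zU => Z xz kz uZ.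
have ne : ((x == k = false) * (k == x = false) * (x == k.+1 = false)
           * (k == k.+1 = false) * (k.+1 == k = false))%type.
  by clear -xk; do !split; apply/eqP; lia.
have {kz}zN : ((forall h, (x, h) \in Z = false) * (forall h, (k, h) \in Z = false)
           * (forall h, (k.+1, h) \in Z = false))%type.
  by split; [split|] => h; apply/negbTE; rewrite ?xz ?kz.
case: (c1) (c2') (odd q) => [] [] [];
  by do 3!rewrite /= ?(cat_uniq, mem_cat, inE, xpair_eqE, zN, ne, uZ, eqxx, andbF).
Qed.

Lemma chorded_trail_extend k j l d : 3 <= d <= k.*2 + 2 + odd k ->
  has_chorded_trail k j l -> has_chorded_trail k.+2 j (l + d).
Proof.
move=> dk F.
(* The detour has length 2q + 3 + c for q even and 2q + 2 + c for q odd. With d - 3 = 4a + r, take q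
   = 2a and c = r if r <= 2, and q = 2a + 1 and c = 2 if r = 3. *)
pose q := ((d - 3) %/ 4).*2 + ((d - 3) %% 4 == 3).
pose c := minn 2 ((d - 3) %% 4).
have oq : odd q = ((d - 3) %% 4 == 3) by rewrite /q oddD odd_double oddb.
have -> : l + d = l + q.+1.*2 + ~~ odd q + c by rewrite oq /q /c; lia.
by apply: chorded_trail_step => //; rewrite /q /c; lia.
Qed.

(** Twice the number of edges is compared with k(k + 1) minus twice the forced losses: (k - 2) / 2
    labels for k even, two labels for k odd when an arc has length 2. The last conjunct excludes one
    sporadic case. *)
Definition room (k j l : nat) : bool :=
  (if odd k then 2 * (j + l + 1) + 4 * (minn j l == 2) <= k * (k + 1)
   else 2 * (j + l + 1) <= k * k + 2)
  && ~~ [&& k == 4, minn j l == 2 & j + l == 8].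

(* The cases of at most eight colours that the inductive step does not reach:
   in each closed walk, the two ends of the chord are the first vertex and the
   one at the position given by the first component. *)
Definition trails (k : nat) : seq (nat * seq nat) :=
  match k with
  | 4 => [::
      (2, [:: 0; 2; 1; 3; 0]);
      (2, [:: 0; 1; 3; 2; 2; 0]);
      (2, [:: 1; 3; 2; 2; 0; 0; 1]);
      (2, [:: 3; 0; 2; 2; 1; 1; 3; 3]);
      (3, [:: 1; 2; 3; 3; 0; 0; 1]);
      (3, [:: 2; 1; 1; 0; 0; 3; 2; 2]);
      (3, [:: 1; 2; 2; 0; 0; 3; 3; 1; 1]);
      (4, [:: 1; 3; 3; 2; 2; 0; 0; 1; 1])]
  | 5 => [::
      (2, [:: 3; 1; 4; 4; 0; 0; 2; 3; 3]);
      (2, [:: 2; 0; 4; 4; 1; 0; 0; 3; 2; 2]);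
      (2, [:: 3; 0; 2; 2; 4; 4; 0; 1; 1; 3; 3]);
      (2, [:: 3; 4; 0; 1; 2; 2; 4; 4; 1; 1; 3; 3]);
      (2, [:: 4; 1; 3; 3; 2; 2; 1; 1; 0; 0; 2; 4; 4]);
      (3, [:: 1; 4; 2; 3; 4; 4; 0; 0; 1; 1]);
      (3, [:: 4; 4; 3; 1; 1; 2; 0; 0; 3; 2; 4]);
      (3, [:: 0; 4; 4; 3; 2; 2; 4; 1; 1; 2; 0; 0]);
      (3, [:: 2; 3; 3; 1; 1; 4; 4; 3; 0; 0; 4; 2; 2]);
      (3, [:: 2; 0; 3; 2; 1; 1; 4; 0; 0; 1; 3; 4; 4; 2]);
      (3, [:: 4; 0; 2; 4; 1; 1; 3; 2; 2; 1; 0; 0; 3; 3; 4]);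
      (4, [:: 0; 0; 1; 4; 4; 3; 3; 1; 2; 0]);
      (4, [:: 4; 4; 0; 2; 2; 1; 0; 0; 3; 3; 4]);
      (4, [:: 2; 4; 4; 0; 0; 3; 3; 1; 1; 4; 3; 2]);
      (4, [:: 0; 2; 4; 3; 0; 1; 3; 2; 1; 1; 4; 4; 0]);
      (4, [:: 3; 2; 2; 1; 3; 0; 0; 4; 4; 1; 0; 2; 4; 3]);
      (4, [:: 0; 3; 3; 2; 0; 1; 1; 4; 3; 1; 2; 2; 4; 4; 0]);
      (5, [:: 4; 4; 3; 3; 0; 0; 1; 1; 2; 2; 4]);
      (5, [:: 4; 2; 1; 1; 0; 3; 3; 2; 2; 0; 4; 4]);
      (5, [:: 2; 4; 3; 1; 1; 2; 3; 0; 0; 4; 1; 0; 2]);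
      (5, [:: 4; 2; 3; 0; 0; 4; 1; 1; 0; 2; 1; 3; 3; 4]);
      (5, [:: 1; 4; 4; 3; 3; 1; 2; 2; 3; 0; 4; 2; 0; 0; 1]);
      (6, [:: 0; 4; 3; 3; 2; 2; 1; 1; 4; 4; 2; 0; 0]);
      (6, [:: 1; 0; 4; 3; 3; 2; 1; 3; 0; 0; 2; 2; 4; 1]);
      (6, [:: 0; 3; 3; 2; 2; 4; 0; 2; 1; 1; 4; 4; 3; 1; 0]);
      (7, [:: 3; 0; 0; 1; 1; 2; 2; 3; 4; 4; 0; 2; 4; 1; 3])]
  | 6 => [::
      (2, [:: 1; 3; 0; 0; 4; 1; 5; 5; 4; 4; 2; 2; 3; 3; 5; 0; 2; 1; 1]);
      (6, [:: 5; 0; 3; 4; 4; 1; 3; 3; 2; 5; 1; 0; 2; 2; 4; 5]);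
      (6, [:: 1; 1; 0; 0; 5; 5; 2; 0; 4; 5; 1; 4; 4; 2; 3; 3; 1]);
      (6, [:: 3; 0; 0; 4; 4; 5; 5; 1; 1; 0; 2; 4; 3; 3; 1; 2; 2; 3]);
      (6, [:: 3; 0; 1; 4; 4; 5; 2; 2; 0; 0; 5; 5; 3; 4; 2; 1; 1; 3; 3]);
      (7, [:: 1; 1; 3; 3; 2; 2; 0; 0; 5; 5; 4; 4; 0; 3; 4; 1]);
      (7, [:: 2; 2; 1; 5; 0; 1; 1; 3; 3; 4; 0; 0; 2; 4; 4; 5; 2]);
      (7, [:: 4; 5; 3; 3; 4; 1; 1; 0; 0; 3; 2; 0; 5; 5; 1; 2; 4; 4]);
      (7, [:: 1; 1; 5; 4; 4; 0; 2; 4; 3; 3; 5; 5; 2; 2; 1; 3; 0; 0; 1]);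
      (8, [:: 5; 0; 0; 3; 3; 2; 2; 4; 4; 1; 3; 5; 5; 2; 0; 1; 5]);
      (8, [:: 1; 0; 5; 5; 4; 4; 1; 5; 2; 4; 3; 3; 2; 2; 0; 0; 3; 1]);
      (8, [:: 2; 2; 5; 0; 2; 3; 0; 0; 1; 1; 5; 5; 4; 4; 1; 3; 3; 4; 2]);
      (9, [:: 0; 4; 1; 5; 5; 4; 4; 3; 3; 1; 1; 2; 2; 5; 0; 0; 2; 3; 0])]
  | 7 => [::
      (12, [:: 2; 4; 4; 0; 0; 1; 1; 3; 3; 6; 6; 5; 5; 3; 0; 6; 4; 5; 0; 2; 3; 4; 1; 2; 2]);
      (12, [:: 6; 2; 2; 4; 4; 6; 3; 1; 1; 5; 4; 1; 6; 5; 3; 4; 0; 1; 2; 5; 0; 2; 3; 3; 0; 6]);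
      (12, [:: 1; 3; 3; 0; 0; 6; 6; 4; 2; 5; 5; 6; 1; 2; 6; 3; 2; 0; 4; 5; 0; 1; 5; 3; 4; 4; 1]);
      (12, [:: 0; 2; 2; 1; 1; 4; 4; 3; 3; 1; 6; 4; 0; 6; 6; 5; 5; 2; 6; 3; 2; 4; 5; 3; 0; 5; 1; 0]);
      (13, [:: 4; 2; 2; 5; 5; 1; 1; 6; 6; 3; 0; 1; 3; 4; 5; 3; 2; 6; 0; 0; 4; 1; 2; 0; 5; 6; 4]);
      (13, [:: 1; 6; 6; 4; 0; 0; 5; 6; 3; 3; 2; 2; 4; 1; 0; 3; 5; 2; 0; 6; 2; 1; 5; 5; 4; 4; 3; 1])]
  | 8 => [::
      (16, [:: 5; 7; 7; 6; 6; 4; 4; 7; 1; 1; 0; 0; 3; 3; 7; 2; 1; 4; 5; 2; 2; 0; 6; 3; 5; 6; 1; 3; 2; 4; 0; 5; 5])]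
  | _ => [::]
  end.

Definition listed (k j l : nat) : bool :=
  has (fun t => (t.1 == j) && (size t.2 == (j + l).+1)) (trails k).

Lemma listedP k j l : 4 <= k <= 8 -> listed k j l -> has_chorded_trail k j l.
Proof.
move=> kb /hasP[[i w] /= wk /andP[/eqP ij /eqP sw]]; subst i.
have chk : all (fun k => all (fun t =>
    chorded_trail k t.1 ((size t.2).-1 - t.1) (head 0 t.2) (behead t.2)) (trails k))
  (iota 4 5) by vm_compute.
have /(allP chk)/allP/(_ _ wk) /= : k \in iota 4 5 by rewrite mem_iota; lia.
rewrite sw /= addKn => H; by exists (head 0 w), (behead w).
Qed.

(** Here [k] counts the old colours. The arc loses the longest available detour but keeps length at
    least 3, so that for 2 <= j <= l the test [minn j l == 2] has the same answer before and
    after. *)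
Definition base (k l : nat) : nat := maxn 3 (l - (k.*2 + 2 + odd k)).

(** From k - 2 to k colours the bound in [room] grows by exactly twice the longest detour, so
    cutting out a full detour preserves it. If the arc is too short for that, it shrinks to 3 and,
    for k >= 9, there is ample slack. *)
Lemma room_cases k j l : 4 <= k -> 2 <= j <= l -> room k j l ->
  [|| (4 < k) && room k.-1 j l,
      [&& 5 < k, room (k - 2) j (base (k - 2) l) & 3 <= l - base (k - 2) l]
    | (k <= 8) && listed k j l].
Proof.
move=> k4 jl rk; have [k8|k9] := leqP k 8; last first.
  case/andP: jl => j2 jl; have [l6|l5] := ltnP l 6.
    apply/orP; left; rewrite /room; apply/andP; split; first by lia.
    by apply/andP; split; [case: ifP => _; nia | lia].
  apply/orP; right; apply/orP; left; apply/and3P; split; [lia| |rewrite /base; lia].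
  have ok : odd (k - 2) = odd k by rewrite oddB //; lia.
  move: rk; rewrite /room ok => /andP[rk _]; apply/andP; split; last by lia.
  have [lf|lf] := leqP 3 (l - ((k - 2).*2 + 2 + odd k)).
    have -> : base (k - 2) l = l - ((k - 2).*2 + 2 + odd k).
      by rewrite /base ok; lia.
    by move: rk; case: (odd k) lf => lf; nia.
  have -> : base (k - 2) l = 3 by rewrite /base ok; lia.
  by case: (odd k) lf {rk} => lf; nia.
(* For k <= 8 the condition [room] forces [j + l < 36], which leaves a finite check. *)
have small : all (fun k => all (fun j => all (fun l => (2 <= j <= l) && room k j l ==>
  [|| (4 < k) && room k.-1 j l,
      [&& 5 < k, room (k - 2) j (base (k - 2) l) & 3 <= l - base (k - 2) l]
    | (k <= 8) && listed k j l]) (iota 0 36)) (iota 0 36)) (iota 4 5) by vm_compute.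
have jl36 : j + l < 36.
  have : k * k <= 64 by nia.
  have : k * (k + 1) <= 72 by nia.
  by move: rk; rewrite /room; case: (odd k) => /= /andP[rk' _]; lia.
move/allP: small => /(_ k); rewrite mem_iota => /(_ _)/allP/(_ j).
rewrite mem_iota => H; move: {H}(H ltac:(lia) ltac:(lia)) => /allP/(_ l).
by rewrite mem_iota jl rk k8 => H; apply: H; lia.
Qed.

Lemma chorded_trail_exists k j l : 4 <= k -> 2 <= j -> 2 <= l ->
  room k j l -> has_chorded_trail k j l.
Proof.
elim/ltn_ind: k j l => k IH j l k4.
(* By symmetry the detour always goes into the longer arc. *)
wlog jl : j l / j <= l => [H j2 l2 r|j2 _ r].
  have [/H|/ltnW lj] := leqP j l; first exact.
  by apply: chorded_trail_sym; apply: H => //; rewrite /room minnC (addnC l).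
have l2 := leq_trans j2 jl.
case/or3P: (room_cases _ _ _ k4 (introT andP (conj j2 jl)) r).
- move=> /andP[k5 r1]; apply: (chorded_trail_mono _ _ _ _ (leq_pred k)).
  by apply: IH => //; lia.
- case/and3P=> k6 r2 d3.
  have -> : k = (k - 2).+2 by lia.
  have -> : l = base (k - 2) l + (l - base (k - 2) l) by lia.
  apply: chorded_trail_extend; last by apply: IH => //; rewrite /base; lia.
  by rewrite d3 /base; lia.
by move=> /andP[k8 /listedP]; apply; lia.
Qed.

(** * Colourings as labellings of the edge list *)

Definition edge_list (n j : nat) : seq (nat * nat) :=
  (0, j) :: [seq (i, i.+1 %% n) | i <- iota 0 n].

Definition labels (n j : nat) (f : nat -> nat) : seq (nat * nat) :=
  [seq lab (f e.1) (f e.2) | e <- edge_list n j].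

Lemma uniq_map_inj (T1 T2 : eqType) (f : T1 -> T2) s :
  uniq (map f s) -> {in s &, injective f}.
Proof.
elim: s => //= x s IH /andP[xs us] y z; rewrite !inE.
case/predU1P=> [->|ys] /predU1P[->|zs] // E; last exact: IH.
- by rewrite E map_f in xs.
by rewrite -E map_f in xs.
Qed.

Lemma edge_listP n j e :
  reflect (e = (0, j) \/ exists2 i, i < n & e = (i, i.+1 %% n))
          (e \in edge_list n j).
Proof.
rewrite inE; apply: (iffP orP) => [[/eqP|/mapP[i]]|[->|[i lt_in ->]]]; first by left.
- by rewrite mem_iota => lt_in ->; right; exists i.
- by left.
by right; apply: map_f; rewrite mem_iota.
Qed.

Lemma next_mod n i : i < n -> i.+1 %% n = if i.+1 == n then 0 else i.+1.
Proof. by case: eqP => [->|ne] lt_in; [rewrite modnn | rewrite modn_small //; lia]. Qed.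

Lemma lab_edge_inj n j : 2 <= j -> 2 * j <= n ->
  {in edge_list n j &, injective (fun e => lab e.1 e.2)}.
Proof.
move=> j2 jn e e' /edge_listP[->|[i lt_in ->]] /edge_listP[->|[i' lt_i'n ->]] //=;
  move/lab_eq; rewrite ?next_mod //; repeat case: eqP => ?; move=> H;
  congr pair; lia.
Qed.

Lemma uniq_edge_list n j : 2 <= j -> 2 * j <= n -> uniq (edge_list n j).
Proof.
move=> j2 jn; rewrite /= map_inj_uniq ?iota_uniq ?andbT => [|i i' []//].
by apply/negP => /mapP[i]; rewrite mem_iota => lt_in [i0]; rewrite -i0 modn_small; lia.
Qed.

Lemma set2_lab m (a b c d : 'I_m) :
  ([set a; b] == [set c; d]) = (lab a b == lab c d).
Proof.
apply/eqP/eqP => [E | /lab_eq[] [/val_inj-> /val_inj->] //]; last exact: setUC.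
have: a \in [set c; d] by rewrite -E set21.
have: b \in [set c; d] by rewrite -E set22.
have: c \in [set a; b] by rewrite E set21.
have: d \in [set a; b] by rewrite E set22.
by rewrite !inE => /orP[] /eqP-> /orP[] /eqP-> /orP[] /eqP E1 /orP[] /eqP E2 //;
  rewrite ?E1 ?E2 // labC ?E1 ?E2.
Qed.

Lemma edge_distinguishingP (G : sgraph) k (c : {ffun G -> 'I_k}) :
  reflect (forall u v u' v', adj u v -> adj u' v' ->
             lab (c u) (c v) = lab (c u') (c v') -> [set u; v] = [set u'; v'])
          (edge_distinguishing c).
Proof.
have im u v : c @: [set u; v] = [set c u; c v] by rewrite imsetU !imset_set1.
apply: (iffP forall_inP) => [ed u v u' v' uv uv' E | ed A].
  have ein x y : adj x y -> [set x; y] \in edges G.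
    by move=> xy; apply/imset2P; exists x y; rewrite ?inE.
  have /forall_inP/(_ _ (ein _ _ uv')) := ed _ (ein _ _ uv).
  by rewrite !im set2_lab E eqxx => /eqP.
case/imset2P=> u v _; rewrite inE => uv ->; apply/forall_inP=> B.
case/imset2P=> u' v' _; rewrite inE => uv' ->; apply/implyP.
by rewrite !im set2_lab => /eqP/(ed _ _ _ _ uv uv')->.
Qed.

(** The listed pairs match the adjacent pairs up to order ([endsP], [adjP]), and [lab] forgets the
    order. *)
Lemma ed_colorableP n j k : 2 <= j -> 2 * j <= n ->
  ed_colorable (cycle_chord n j) k <->
  0 < k /\ exists2 f, (forall i, i < n -> f i < k) & uniq (labels n j f).
Proof.
case: n => [|n] j2 jn; first by lia.
have endsP e : e \in edge_list n.+1 j ->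
  [/\ e.1 < n.+1, e.2 < n.+1 & cycle_chord_adj j (inord e.1 : 'I_n.+1) (inord e.2)].
  move=> eE; have e12 : (e.1 < n.+1) && (e.2 < n.+1) && (e.1 != e.2).
    case/edge_listP: eE => [->|[i lt_in ->]] /=; first by lia.
    by rewrite next_mod //; case: eqP; lia.
  case/andP: e12 => /andP[e1 e2] e12; split=> //.
  rewrite /cycle_chord_adj /cycle_or_chord -val_eqE /= !inordK // e12 /=.
  by case/edge_listP: eE => [->|[i _ ->]]; rewrite /= !eqxx ?orbT.
have adjP (u v : 'I_n.+1) : cycle_chord_adj j u v ->
  exists2 e, e \in edge_list n.+1 j & e = (u : nat, v : nat) \/ e = (v : nat, u : nat).
  case/andP=> _ /orP[]/orP[/eqP uv|/andP[/eqP u0 /eqP vj]].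
  - by exists (u : nat, v : nat); [apply/edge_listP; right; exists u; rewrite ?uv | left].
  - by exists (u : nat, v : nat); [apply/edge_listP; left; rewrite u0 vj | left].
  - by exists (v : nat, u : nat); [apply/edge_listP; right; exists v; rewrite ?uv | right].
  - by exists (v : nat, u : nat); [apply/edge_listP; left; rewrite u0 vj | right].
split=> [/andP[k0 /existsP[c /edge_distinguishingP ed]]|[k0 [f fk uf]]].
  split=> //; exists (fun i => val (c (inord i))) => [i _|]; first exact: ltn_ord.
  rewrite map_inj_in_uniq ?uniq_edge_list // => e e' eE e'E /ed E.
  have [e1 e2 adj_e] := endsP _ eE; have [e1' e2' adj_e'] := endsP _ e'E.
  apply: (lab_edge_inj n.+1 j) => //; move/eqP: (E adj_e adj_e').
  by rewrite set2_lab !inordK // => /eqP.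
apply/andP; split=> //; apply/existsP.
exists [ffun u : 'I_n.+1 => Ordinal (fk u (ltn_ord u))].
apply/edge_distinguishingP => u v u' v' /adjP[e eE euv] /adjP[e' e'E euv'].
rewrite !ffunE /= => E; apply/eqP; rewrite set2_lab.
have ee : e = e'.
  apply: (uniq_map_inj _ _ _ _ uf) => //.
  by case: euv E => ->; case: euv' => -> //=; rewrite ?[lab (f v) _]labC ?[lab (f v') _]labC.
by move: euv'; rewrite -ee; case: euv => -> [] [-> ->] //; rewrite labC.
Qed.

Lemma labels_of_chorded_trail k j l : 0 < j -> has_chorded_trail k j l ->
  exists2 f, (forall i, i < j + l -> f i < k) & uniq (labels (j + l) j f).
Proof.
move=> j0 [x [s /and4P[/eqP ss /eqP ls sk us]]].
exists (nth x (x :: s)) => [i i_lt|].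
  by apply: (allP sk); rewrite mem_nth //= ss; lia.
suff -> : labels (j + l) j (nth x (x :: s)) =
          lab x (nth x (x :: s) j) :: pairmap lab x s by [].
rewrite /labels /= -map_comp; congr cons.
apply: (@eq_from_nth _ (0, 0)); rewrite !size_map size_iota ?size_pairmap ?ss //.
move=> i i_lt; rewrite (nth_map 0) ?size_iota // nth_iota //= (nth_pairmap x) ?ss //.
(* At the last index the successor wraps to 0, and the trail is back at [x]. *)
rewrite next_mod //; case: eqP => [iE|_] //=.
by congr lab; rewrite -[LHS]ls (last_nth x) ss -iE.
Qed.

(** * Parity obstructions *)

Lemma odd_count_addb (T : Type) (a b : pred T) s :
  odd (count (fun x => a x (+) b x) s) = odd (count a s) (+) odd (count b s).
Proof.
elim: s => //= x s IH; rewrite !oddD IH !oddb.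
by case: (a x) (b x) (odd _) (odd _) => [] [] [] [].
Qed.

Lemma rot_iota n : [seq i.+1 %% n | i <- iota 0 n] = rot 1 (iota 0 n).
Proof.
case: n => // n; transitivity (rcons (iota 1 n) 0); last by rewrite -rot1_cons.
have -> : iota 0 n.+1 = iota 0 n ++ [:: n] by rewrite -addn1 iotaD.
rewrite map_cat /= modnn cats1; congr rcons; rewrite (iotaDl 1 0 n : iota 1 n = _).
by apply/eq_in_map => i; rewrite mem_iota => i_lt; rewrite modn_small //; lia.
Qed.

(** The exclusive or discards the loop at [v], which would not affect the parity of the degree. *)
Definition nonloop_at (v : nat) (p : nat * nat) : bool := (p.1 == v) (+) (p.2 == v).

Lemma nonloop_at_lab v a b : nonloop_at v (lab a b) = (a == v) (+) (b == v).
Proof.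
by rewrite /nonloop_at /lab /=; case: (ltngtP a b) => [||->] //; rewrite addbC.
Qed.

(** Since i -> i + 1 mod n permutes the indices, the counts of [v] at the two ends of the cycle
    steps cancel modulo 2, and only the chord remains. *)
Lemma odd_nonloops n j f v :
  odd (count (nonloop_at v) (labels n j f)) = (f 0 == v) (+) (f j == v).
Proof.
rewrite count_map /= oddD oddb nonloop_at_lab count_map.
rewrite (eq_count (a2 := fun i => (f i == v) (+) (f (i.+1 %% n) == v))); last first.
  by move=> i; rewrite /= nonloop_at_lab.
rewrite odd_count_addb -(count_map (fun i => i.+1 %% n) (fun i => f i == v)).
have /permP perm : perm_eq (rot 1 (iota 0 n)) (iota 0 n) by rewrite perm_rot.
by rewrite rot_iota perm addbb addbF.
Qed.

(** Were no label joining [v] to another colour missing, the non-loop labels at [v] would be exactly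
    these k - 1, against the parity in [odd_nonloops]. *)
Lemma missing_nonloop n j k f v : uniq (labels n j f) ->
  {in labels n j f, forall p, p.2 < k} -> v < k ->
  odd k.-1 != (f 0 == v) (+) (f j == v) ->
  exists u, [/\ u < k, u != v & lab u v \notin labels n j f].
Proof.
move=> uL Lk vk odd_ne.
have inr u : u \in rem v (iota 0 k) = (u != v) && (u < k).
  by rewrite mem_rem_uniq ?iota_uniq // !inE mem_iota.
have [/allP all_in|/allPn[u]] :=
  boolP (all (fun u => lab u v \in labels n j f) (rem v (iota 0 k))); last first.
  by rewrite inr => /andP[uv uk] nin; exists u.
case/negP: odd_ne; rewrite -(odd_nonloops n) -size_filter; apply/eqP.
have -> : k.-1 = size [seq lab u v | u <- rem v (iota 0 k)].
  by rewrite size_map size_rem ?size_iota // mem_iota.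
congr odd; apply: perm_size; apply: uniq_perm; rewrite ?filter_uniq //.
  rewrite map_inj_uniq ?rem_uniq ?iota_uniq // => u u' /lab_eq; lia.
move=> p; rewrite mem_filter; apply/mapP/andP => [[u]|[pv pL]].
  move=> ur ->; rewrite all_in // nonloop_at_lab eqxx.
  by move: ur; rewrite inr => /andP[/negbTE->].
have [p1k p12] : p.1 < k /\ p.1 <= p.2.
  by have := Lk _ pL; case/mapP: pL => e _ -> /=; lia.
have p2k := Lk _ pL; move: pv p1k p2k p12; case: p {pL} => a b.
rewrite /nonloop_at /=; case: eqP => [->|nav]; case: eqP => [->|nbv] //= _ ak bk ab.
  by exists b; rewrite ?inr ?bk ?andbT 1?labC; [apply/eqP | rewrite lab_lt //; lia].
by exists a; rewrite ?inr ?ak ?andbT; [apply/eqP | rewrite lab_lt //; lia].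
Qed.

(** * Counting the missing labels *)

Fixpoint all_labels (k : nat) : seq (nat * nat) :=
  if k is k'.+1 then all_labels k' ++ [seq (u, k') | u <- iota 0 k] else [::].

Lemma mem_all_labels k p : (p \in all_labels k) = (p.1 <= p.2 < k).
Proof.
elim: k => [|k IH]; first by rewrite andbF.
rewrite mem_cat IH; apply/orP/idP => [[|/mapP[u]]|p12].
- by lia.
- by rewrite mem_iota => uk -> /=; lia.
have [|p2k] := ltnP p.2 k; [left | right]; first by lia.
by apply/mapP; exists p.1; rewrite ?mem_iota; [|rewrite {1}[p]surjective_pairing; congr pair]; lia.
Qed.

Lemma uniq_all_labels k : uniq (all_labels k).
Proof.
elim: k => // k IH; rewrite cat_uniq IH andTb.
rewrite map_inj_uniq ?iota_uniq ?andbT => [|u u' []//].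
by apply/hasPn => _ /mapP[u _ ->]; rewrite mem_all_labels /= ltnn andbF.
Qed.

Lemma size_all_labels k : 2 * size (all_labels k) = k * k.+1.
Proof.
elim: k => // k IH; rewrite size_cat mulnDr IH size_map size_iota; lia.
Qed.

Definition missing n j k f := [seq p <- all_labels k | p \notin labels n j f].

Lemma mem_missing n j k f u v : u < k -> v < k -> lab u v \notin labels n j f ->
  lab u v \in missing n j k f.
Proof.
by move=> uk vk nin; rewrite mem_filter nin mem_all_labels /=; lia.
Qed.

Lemma size_missing n j k f : uniq (labels n j f) ->
  {in labels n j f, forall p, p.2 < k} ->
  2 * (n.+1 + size (missing n j k f)) = k * k.+1.
Proof.
move=> uL Lk; rewrite -size_all_labels; congr (2 * _).
have -> : n.+1 = size [seq p <- all_labels k | p \in labels n j f].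
  have <- : size (labels n j f) = n.+1 by rewrite !size_map /= size_map size_iota.
  apply: perm_size; apply: uniq_perm; rewrite ?filter_uniq ?uniq_all_labels //.
  move=> p; rewrite mem_filter mem_all_labels andbC.
  case: (boolP (p \in _)) => [pL|]; rewrite ?andbF ?andbT //.
  by rewrite (Lk _ pL) andbT; case/mapP: pL => e _ -> /=; lia.
by rewrite !size_filter count_predC.
Qed.

Section Colouring.
Variables (n j k : nat) (f : nat -> nat).
Hypotheses (j2 : 2 <= j) (jn : 2 * j <= n) (fk : forall i, i < n -> f i < k).
Hypothesis uL : uniq (labels n j f).

Let L := labels n j f.

Lemma mem_chord : lab (f 0) (f j) \in L. Proof. exact: mem_head. Qed.

Lemma mem_step i : i < n -> lab (f i) (f (i.+1 %% n)) \in L.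
Proof.
move=> lt_in; apply/mapP; exists (i, i.+1 %% n) => //.
by apply/edge_listP; right; exists i.
Qed.

Lemma step_inj i i' : i < n -> i' < n ->
  lab (f i) (f (i.+1 %% n)) = lab (f i') (f (i'.+1 %% n)) -> i = i'.
Proof.
move=> lt_in lt_i'n E.
have step m : m < n -> (m, m.+1 %% n) \in edge_list n j.
  by move=> mn; apply/edge_listP; right; exists m.
by have [] := uniq_map_inj _ _ _ _ uL _ _ (step i lt_in) (step i' lt_i'n) E.
Qed.

Lemma step_neq_chord i : i < n -> lab (f i) (f (i.+1 %% n)) <> lab (f 0) (f j).
Proof.
move=> lt_in E; have := uL; rewrite /= => /andP[/negP[]].
by rewrite -E -map_comp; apply/mapP; exists i; rewrite ?mem_iota.
Qed.

Lemma labels_bound : {in L, forall p, p.2 < k}.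
Proof.
move=> _ /mapP[e /edge_listP[->|[i lt_in ->]] ->]; rewrite /= gtn_max !fk //.
- by lia.
- by lia.
by rewrite ltn_mod; lia.
Qed.

Let U := missing n j k f.

Lemma missing_at v : v < k -> odd k.-1 != (f 0 == v) (+) (f j == v) ->
  exists u, [/\ u < k, u != v, lab u v \notin L & lab u v \in U].
Proof.
move=> vk /(missing_nonloop _ _ _ _ _ uL labels_bound vk)[u [uk uv nin]].
by exists u; split=> //; apply: mem_missing.
Qed.

(** By parity, the two ends of the chord and the ends of the missing labels together cover all
    colours. *)
Lemma leq_missing_even : 0 < k -> ~~ odd k -> k <= 2 * size U + 2.
Proof.
move=> k0 ek.
have -> : 2 * size U + 2 = size (f 0 :: f j :: flatten [seq [:: p.1; p.2] | p <- U]).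
  by rewrite /=; elim: (U) => //= p s; lia.
rewrite -[leqLHS](size_iota 0); apply: uniq_leq_size; rewrite ?iota_uniq // => v.
rewrite mem_iota !inE /= => vk; case: eqVneq => //= v0; case: eqVneq => //= vj.
have /missing_at : odd k.-1 != (f 0 == v) (+) (f j == v).
  rewrite (eq_sym (f 0)) (eq_sym (f j)) (negbTE v0) (negbTE vj).
  by case: (k) k0 ek => //= m _; rewrite negbK => ->.
move=> /(_ vk)[u [uk uv nin uU]]; apply/flattenP.
exists [:: (lab u v).1; (lab u v).2]; first exact: (map_f (fun p => [:: p.1; p.2])).
by rewrite !inE /=; lia.
Qed.

(** The chord closes a triangle on 0, 1, 2; two equal colours there would give two of its edges the
    same label. *)
Lemma chord_two : j = 2 -> [/\ f 0 != f 1, f 1 != f 2 & f 0 != f 2].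
Proof.
move=> jE; have n4 : 4 <= n by lia.
have m1 : 1 %% n = 1 by rewrite modn_small //; lia.
have m2 : 2 %% n = 2 by rewrite modn_small //; lia.
have c0 := @step_neq_chord 0; have c1 := @step_neq_chord 1.
have c01 := @step_inj 0 1; rewrite m1 m2 jE in c0 c1 c01.
split; apply/eqP => E.
- by apply: c1; [lia | rewrite E].
- by apply: c0; [lia | rewrite E].
by have := c01; rewrite E labC; move=> H; have := H ltac:(lia) ltac:(lia) erefl.
Qed.

Lemma leq_missing_odd : j = 2 -> odd k -> 2 <= size U.
Proof.
move=> jE ok; have [_ _ ne] := chord_two jE.
have k1 : odd k.-1 = false by case: (k) ok => //= m /negbTE.
have chord := mem_chord; rewrite jE in chord.
have [u [uk u0 nin0 uU]] : exists u, [/\ u < k, u != f 0, lab u (f 0) \notin L & lab u (f 0) \in U].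
  by apply: missing_at; rewrite ?fk ?k1 ?jE ?eqxx 1?eq_sym ?(negbTE ne) //; lia.
have [u' [uk' u0' nin0' uU']] : exists u, [/\ u < k, u != f 2, lab u (f 2) \notin L & lab u (f 2) \in U].
  by apply: missing_at; rewrite ?fk ?k1 ?jE ?eqxx ?(negbTE ne) //; lia.
have -> : 2 = size [:: lab u (f 0); lab u' (f 2)] by [].
apply: uniq_leq_size => [|p]; last by rewrite !inE => /orP[]/eqP->.
(* If the two labels agreed, they would be the label of the chord, which is present. *)
rewrite /= inE andbT; apply/eqP => /lab_eq[[E1 E2]|[E1 E2]].
  by rewrite E2 eqxx in ne.
by move: nin0; rewrite E1 labC chord.
Qed.

(* With four colours and nine edges a single label {a, u} is missing, where
   a = f 1: the loop at a then has to be preceded by one of the labels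
   {f 0, a} and {a, f 2}, which are both used up by the first two edges. *)
Lemma no_four_colours_nine_edges : j = 2 -> n = 8 -> k <> 4.
Proof.
move=> jE nE kE; have [n01 n12 n02] := chord_two jE.
have fl i : i < 8 -> f i < 4 by move=> i8; rewrite -kE fk // nE.
have U1 : size U = 1.
  by have := size_missing _ _ _ _ uL labels_bound; rewrite -/U nE kE; lia.
have [u [uk u1 nin uU]] : exists u, [/\ u < k, u != f 1, lab u (f 1) \notin L & lab u (f 1) \in U].
  apply: missing_at; first by apply: fk; lia.
  by rewrite kE jE (negbTE n01) (eq_sym (f 2)) (negbTE n12).
have st i : i < 7 -> lab (f i) (f i.+1) \in L.
  by move=> i7; have := @mem_step i; rewrite nE modn_small //; apply; lia.
have inj i i' : i < 7 -> i' < 7 -> lab (f i) (f i.+1) = lab (f i') (f i'.+1) -> i = i'.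
  by move=> i7 i7'; have := @step_inj i i'; rewrite nE !modn_small //; apply; lia.
have u0 : u != f 0 by apply: contraNneq nin => ->; apply: st.
have u2 : u != f 2 by apply: contraNneq nin => ->; rewrite labC; apply: st.
(* Of the ten labels only one is missing, and it is not a loop. *)
have : lab (f 1) (f 1) \in L.
  apply: contraT => nin1.
  have aU : lab (f 1) (f 1) \in U by apply: mem_missing; rewrite // kE fl.
  have : size [:: lab u (f 1); lab (f 1) (f 1)] <= size U.
    apply: uniq_leq_size => [|p]; last by rewrite !inE => /orP[]/eqP->.
    rewrite /= inE andbT; apply/eqP => /lab_eq H; move: u1; case: H => [] [-> _];
    by rewrite eqxx.
  by rewrite U1.
case/mapP=> e /edge_listP[->|[i lt_in ->]] /= /lab_eq E.
  by move: n01; case: E => [] [E1 E2]; rewrite ?E1 ?E2 -?E1 -?E2 eqxx.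
have [fi fi'] : f i = f 1 /\ f (i.+1 %% n) = f 1 by case: E => [] [].
(* The loop is step [i]. Steps 0, 1, 2 and 7 have an end coloured [f 0] or [f 2], so 3 <= i <= 6 and
   step i - 1 is neither step 0 nor step 1. *)
have i0 : i <> 0 by move=> iE; move: n01; rewrite -fi iE eqxx.
have i1 : i <> 1 by move=> iE; move: n12; rewrite -fi' iE nE eqxx.
have i2 : i <> 2 by move=> iE; move: n12; rewrite -fi iE eqxx.
have i7 : i <> 7 by move=> iE; move: n01; rewrite -fi' iE nE modnn eqxx.
have iE : i = i.-1.+1 by lia.
have {}fi' : f i.+1 = f 1 by rewrite -fi' nE modn_small //; lia.
have i17 : i.-1 < 7 by lia.
have i67 : i < 7 by lia.
have s := st _ i17; rewrite -iE fi in s.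
have w0 : f i.-1 != f 0.
  by apply/eqP => w0; have := inj i.-1 0 i17 isT; rewrite -iE fi w0 => /(_ erefl); lia.
have w2 : f i.-1 != f 2.
  by apply/eqP => w2; have := inj i.-1 1 i17 isT; rewrite -iE fi w2 labC => /(_ erefl); lia.
have w1 : f i.-1 != f 1.
  by apply/eqP => w1; have := inj i.-1 i i17 i67; rewrite -iE fi fi' w1 => /(_ erefl); lia.
have wu : f i.-1 != u by apply: contraNneq nin => <-.
(* The colour just before the loop would be a fifth one. *)
have : size [:: f 0; f 1; f 2; u; f i.-1] <= size (iota 0 4).
  apply: uniq_leq_size => [|v].
    by rewrite /= !inE !negb_or n01 n12 n02 /= ![_ == u]eq_sym u0 u1 u2 ![_ == f i.-1]eq_sym w0 w1 w2 wu.
  rewrite mem_iota add0n leq0n -kE !inE => /or4P[|||/orP[]] /eqP-> //;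
    by rewrite fk ?nE // ltnW.
by [].
Qed.

Lemma colouring_room : 0 < k -> room k j (n - j).
Proof.
move=> k0; have sz := size_missing _ _ _ _ uL labels_bound; rewrite -/U in sz.
have m2 : (minn j (n - j) == 2) = (j == 2) by lia.
rewrite /room m2; apply/andP; split; last first.
  apply/negP => /and3P[/eqP k4 /eqP jE n8].
  by apply: no_four_colours_nine_edges k4 => //; lia.
case: ifPn => [ok|/(leq_missing_even k0)]; last by nia.
by case: eqP => [/leq_missing_odd/(_ ok)|_]; nia.
Qed.

End Colouring.

(** * The chromatic number *)

Lemma ed_colorable_mono n j k k' : 2 <= j -> 2 * j <= n -> k <= k' ->
  ed_colorable (cycle_chord n j) k -> ed_colorable (cycle_chord n j) k'.
Proof.
move=> j2 jn kk' /ed_colorableP-/(_ j2 jn)[k0 [f fk uf]].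
apply/ed_colorableP => //; split; first exact: leq_trans kk'.
by exists f => // i /fk /leq_trans; apply.
Qed.

(** Failure of [room] at m - 1 alone excludes all smaller numbers, as a colouring with fewer colours
    is also one with m - 1. *)
Lemma ed_chromatic_eq n j m : 2 <= j -> 2 * j <= n -> 4 <= m ->
  room m j (n - j) -> ~~ room m.-1 j (n - j) -> ed_chromatic (cycle_chord n j) = m.
Proof.
move=> j2 jn m4 rm nrm; rewrite /ed_chromatic; case: ex_minnP => m0 col min.
have m0m : m0 <= m.
  apply: min; apply/ed_colorableP => //; split; first by lia.
  have -> : n = j + (n - j) by lia.
  by apply: labels_of_chorded_trail; [lia | apply: chorded_trail_exists => //; lia].
apply/eqP; rewrite eqn_leq m0m leqNgt; apply: contra nrm => m0lt.
have m0m1 : m0 <= m.-1 by lia.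
have /ed_colorableP-/(_ j2 jn)[k0 [f fk uf]] := ed_colorable_mono _ _ _ _ j2 jn m0m1 col.
exact: colouring_room uf k0.
Qed.

Lemma room_diff n j k : 2 <= j -> 2 * j <= n -> room k j (n - j) =
  (if odd k then 2 * (n + 1) + 4 * (j == 2) <= k * k + k
   else 2 * (n + 1) <= k * k + 2) && ~~ [&& k == 4, j == 2 & n == 8].
Proof.
move=> j2 jn; rewrite /room subnKC; last by lia.
have -> : (minn j (n - j) == 2) = (j == 2) by lia.
by rewrite (mulnDr k) muln1.
Qed.

(** * Ceilings of square roots and the closed formulas *)

Local Open Scope ring_scope.

Lemma sqrt_nat_bounds (R : realType) (p a q : nat) :
  (p * p < a <= q * q)%N -> p%:R < Num.sqrt (a%:R : R) <= q%:R.
Proof.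
have sq (i : nat) : i%:R = Num.sqrt ((i * i)%:R : R).
  by rewrite natrM -expr2 sqrtr_sqr ger0_norm.
case/andP=> pa aq; rewrite (sq p) (sq q) ltr_sqrt ?ler_sqrt ?ltr_nat ?ler_nat //.
  by rewrite pa.
by rewrite ltr0n; lia.
Qed.

Lemma ceil_sqrt (R : realType) (a m : nat) : (0 < m)%N ->
  (m.-1 * m.-1 < a <= m * m)%N -> Num.ceil (Num.sqrt (a%:R : R)) = m%:Z.
Proof.
case: m => // m _ /(sqrt_nat_bounds R) H; apply: ceil_def.
by have -> : m.+1%:Z - 1 = m%:Z by lia.
Qed.

(** The number (-1 + sqrt a) / 2 lies in (m - 1, m] exactly when sqrt a lies in (2m - 1, 2m + 1]. *)
Lemma ceil_half_sqrt (R : realType) (a : nat) : (1 < a)%N ->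
  exists m, [/\ (0 < m)%N, ((2 * m - 1) * (2 * m - 1) < a <= (2 * m + 1) * (2 * m + 1))%N
    & Num.ceil ((-1 + Num.sqrt (a%:R : R)) / 2) = m%:Z].
Proof.
move=> a1; have ex : exists m, (a <= (2 * m + 1) * (2 * m + 1))%N by exists a; nia.
case: (ex_minnP ex) => -[|m] am min; first by lia.
exists m.+1; have bnd : ((2 * m.+1 - 1) * (2 * m.+1 - 1) < a <= (2 * m.+1 + 1) * (2 * m.+1 + 1))%N.
  rewrite am andbT ltnNge; apply/negP => am'.
  have E : (2 * m.+1 - 1 = 2 * m + 1)%N by lia.
  by rewrite E in am'; have := min m am'; rewrite ltnn.
split=> //; apply: ceil_def; have /andP[] := sqrt_nat_bounds R _ _ _ bnd.
have -> : (2 * m.+1 - 1 = 2 * m + 1)%N by lia.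
have -> : (m.+1%:Z - 1 = m%:Z) by lia.
have mE : m.+1%:R = m%:R + 1 :> R by rewrite -natr1.
by rewrite -!pmulrn !natrD !natrM mE => lo hi; apply/andP; split; lra.
Qed.

Theorem theorem4p2 (R : realType) (n j e : nat)
  (hj : (2 <= j)%N) (hjn : (2 * j <= n)%N) (he : e = (n + 1)%N) :
  (let m : int := Num.ceil ((-1 + Num.sqrt (8 * e%:R + 17)) / 2 : R) in
   (ed_chromatic (cycle_chord n 2))%:Z =
     if (e <= 8)%N then 4
     else if e == 9%N then 5
     else if (10 <= e)%N && odd `|m|%N then m
     else Num.ceil (Num.sqrt (2 * e%:R - 2) : R))
  /\
  ((3 <= j)%N ->
   let m : int := Num.ceil ((-1 + Num.sqrt (8 * e%:R + 1)) / 2 : R) in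
   (ed_chromatic (cycle_chord n j))%:Z =
     if (e <= 6)%N then 4
     else if (7 <= e)%N && odd `|m|%N then m
     else Num.ceil (Num.sqrt (2 * e%:R - 2) : R)).
Proof.
have sqE : 2 * e%:R - 2 = (2 * n)%:R :> R by rewrite he natrD natrM; ring.
(* Squares are expanded once, so that [m * m] can serve as an atom for linear arithmetic. *)
have sqr m : (0 < m)%N -> [/\ m.-1 * m.-1 + 2 * m = m * m + 1,
    (2 * m - 1) * (2 * m - 1) + 4 * m = 4 * (m * m) + 1,
    (2 * m + 1) * (2 * m + 1) = 4 * (m * m) + 4 * m + 1
    & m.+1 * m.+1 = m * m + 2 * m + 1]%N.
  by case: m => // i _; split; rewrite /=; nia.
have odd_pred m : (0 < m)%N -> odd m.-1 = ~~ odd m by case: m => //= i; rewrite negbK.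
have chi i k : (2 <= i)%N -> (2 * i <= n)%N -> (4 <= k)%N ->
    room k i (n - i) && ~~ room k.-1 i (n - i) -> ed_chromatic (cycle_chord n i) = k.
  by move=> i2 ni k4 /andP[]; apply: ed_chromatic_eq.
rewrite sqE; split=> [|j3] /=.
  have j2 : (2 * 2 <= n)%N by lia.
  have -> : 8 * e%:R + 17 = (8 * e + 17)%:R :> R by rewrite natrD natrM.
  (* This [m] is the least number with 2e + 4 <= m^2 + m, the odd case of [room] for j = 2. *)
  have [m [m0 mb ->]] := ceil_half_sqrt R (8 * e + 17) ltac:(lia).
  have [s1 s2 s3 s4] := sqr m m0; have om1 := odd_pred m m0.
  have [e8|e9] := leqP e 8; first by rewrite (chi _ 4%N) // !room_diff //=; lia.
  have [e9'|ne9] := eqVneq e 9%N; first by rewrite (chi _ 5%N) // !room_diff //=; lia.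
  have m5 : (5 <= m)%N by nia.
  have mm : (5 * m <= m * m)%N by rewrite leq_mul2r m5 orbT.
  have -> : (10 <= e)%N by lia.
  rewrite absz_nat andTb; case: ifPn => om.
    congr Posz; apply: chi => //; first by lia.
    rewrite !room_diff // om1 om /=.
    (* For m = 5 four colours are excluded by e >= 10; from 6 on the lower bound on [e] given by [m]
       is enough. *)
    have [E|m6] := eqVneq m 5%N; first by rewrite E /=; lia.
    have m6' : (6 <= m)%N by lia.
    have mm6 : (6 * m <= m * m)%N by rewrite leq_mul2r m6' orbT.
    by lia.
  have m6 : (6 <= m)%N by case: (eqVneq m 5%N) om => [->//|]; lia.
  have mm6 : (6 * m <= m * m)%N by rewrite leq_mul2r m6 orbT.
  (* For m even, [m] colours suffice if 2e <= m^2 + 2 and otherwise m + 1 are needed; either way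
     this is the ceiling of the root of 2n. *)
  have [fit|tight] := leqP (2 * e) (m * m + 2).
    rewrite (ceil_sqrt R _ m) //; last by lia.
    congr Posz; apply: chi => //; first by lia.
    by rewrite !room_diff // om1 (negbTE om) /=; lia.
  rewrite (ceil_sqrt R _ m.+1) /=; [|lia..].
  congr Posz; apply: chi => //; first by lia.
  by rewrite !room_diff //= (negbTE om) /=; lia.
have -> : 8 * e%:R + 1 = (8 * e + 1)%:R :> R by rewrite natrD natrM.
(* Now [m] is the least number with 2e <= m^2 + m, the odd case of [room] for j >= 3. *)
have [m [m0 mb ->]] := ceil_half_sqrt R (8 * e + 1) ltac:(lia).
have [s1 s2 s3 s4] := sqr m m0; have om1 := odd_pred m m0.
have m4 : (4 <= m)%N.
  rewrite ltnNge; apply/negP => m3.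
  by have : (m * m <= 3 * m)%N; [rewrite leq_mul2r m3 orbT | lia].
have mm : (4 * m <= m * m)%N by rewrite leq_mul2r m4 orbT.
have -> : (e <= 6)%N = false by lia.
have -> : (7 <= e)%N by lia.
have nj2 : (j == 2%N) = false by lia.
rewrite absz_nat andTb; case: ifPn => om.
  congr Posz; apply: chi => //.
  by rewrite !room_diff // om1 om nj2 /=; lia.
have [fit|tight] := leqP (2 * e) (m * m + 2).
  rewrite (ceil_sqrt R _ m) //; last by lia.
  congr Posz; apply: chi => //.
  by rewrite !room_diff // om1 (negbTE om) nj2 /=; lia.
rewrite (ceil_sqrt R _ m.+1) /=; [|lia..].
congr Posz; apply: chi => //; first by lia.
by rewrite !room_diff //= (negbTE om) nj2 /=; lia.
Qed.
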